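(* Let $q$ be an odd prime power, $t\ge 3$ an integer, $s$ a positive integer with $\gcd(s,t)=1$, $E=\{x\in\mathbb{F}_{q^{2t}}\colon x^{q^t}+x=0\}$, and $w\in E$, $w\neq0$, with $\mathrm{N}_{q^t/q}(w^2)\ne(-1)^t$. Let $T=T_{s,w,\mathbb{F}_{q^t}}=\{x+wx^{q^s}\colon x\in\mathbb{F}_{q^t}\}$. For any $\mu\in\mathbb{F}_{q^t}$ such that $\mathrm{N}_{q^t/q}(\mu)=1$ and $\mu\ne1$, the linear set $L_{T^2}\subseteq\mathrm{PG}(1,q^{2t})$ is equivalent up to the action of $\mathrm{GL}(2,q^{2t})$ to $L_f$, where $$\begin{aligned} f=&(\mu^{q^s}-1)\left((\mu+1)X^{q^t}-2w^{-q^{t-s}}(X^{q^{t-s}}-X^{q^{2t-s}})\right)\\ &+(\mu-1)\left((\mu^{q^s}+1)X^{q^t}+2w\mu^{q^s}(X^{q^s}+X^{q^{t+s}})\right). \end{aligned}$$ For even $t$, an admissible choice for $f$ (i.e. a polynomial $f$ such that $L_{T^2}$ is equivalent to $L_f$ up to the action of $\mathrm{GL}(2,q^{2t})$) is $$f=X^{q^s}+X^{q^{t+s}}+m(X^{q^{t-s}}-X^{q^{2t-s}}),$$ where $m$ is the $(q+1)$-th power of a (suitable) nonzero element of $E$.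
   Context: $\mathrm{N}_{q^t/q}(x)=x^{(q^t-1)/(q-1)}$ for $x\in\mathbb{F}_{q^t}$. For an $\mathbb{F}_q$-subspace $U$ of $\mathbb{F}_{q^{2t}}^2$, $L_U=\{\langle v\rangle_{\mathbb{F}_{q^{2t}}}\colon v\in U,\ v\neq0\}\subseteq\mathrm{PG}(1,q^{2t})$. For an $\mathbb{F}_q$-linearized polynomial $f\in\mathbb{F}_{q^{2t}}[X]$, $U_f=\{(x,f(x))\colon x\in\mathbb{F}_{q^{2t}}\}$ and $L_f=L_{U_f}$. Exponents $j$ in the Frobenius powers $x\mapsto x^{q^j}$ on $\mathbb{F}_{q^{2t}}$ are read modulo $2t$. $T^2=T\times T\subseteq\mathbb{F}_{q^{2t}}^2$. *)

(* Defs.v *)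
From HB Require Import structures.
From mathcomp Require Import all_boot all_order all_algebra all_fingroup.
Set Implicit Arguments.
Unset Strict Implicit.
Unset Printing Implicit Defensive.

Import Order.TTheory GRing.Theory Num.Theory.
Local Open Scope ring_scope.

Definition prime_power (q : nat) : Prop :=
  exists p e : nat, [/\ prime p, (0 < e)%N & q = (p ^ e)%N].

(* In everything that follows the finite field L is meant to have q ^ (2 * t)
   elements, so that its subfields of order q and q ^ t are the sets of roots
   of X^q - X and X^(q^t) - X. *)

(* q ^ (j mod 2t). The exponent j is an integer because t - s and 2t - s may be
   negative; the division is Euclidean, so the residue is nonnegative. *)
Definition qpow (q t : nat) (j : int) : nat :=
  (q ^ `|(j %% (2 * t)%:Z)%Z|)%N.

Section FiniteField.

Variable L : finFieldType.

Definition subfield_qt (q t : nat) : {set L} := [set x : L | x ^+ (q ^ t) == x].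

Definition norm_qt (q t : nat) (x : L) : L := x ^+ ((q ^ t - 1) %/ (q - 1)).

Definition Eset (q t : nat) : {set L} := [set x : L | x ^+ (q ^ t) + x == 0].

Definition Tset (q t s : nat) (w : L) : {set L} :=
  [set x + w * x ^+ (q ^ s) | x in subfield_qt q t].

Definition vec2 (x y : L) : 'rV[L]_2 := \row_(i < 2) (if i == 0 then x else y).

Definition square (A : {set L}) : {set 'rV[L]_2} := [set vec2 a b | a in A, b in A].

Definition graph (f : {poly L}) : {set 'rV[L]_2} := [set vec2 x f.[x] | x : L].

(* The points of PG(1, L) are the subspaces of L^2 of dimension 1, and a set of
   points is a predicate on subspaces. *)
Definition linear_set (U : {set 'rV[L]_2}) : {vspace 'rV[L]_2} -> Prop :=
  fun P => exists v : 'rV[L]_2, [/\ v \in U, v != 0 & P = <[v]>%VS].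

Definition GL_act (g : {'GL_2[L]}) (P : {vspace 'rV[L]_2}) : {vspace 'rV[L]_2} :=
  (linfun (mulmxr (GLval g)) @: P)%VS.

Definition GL_equiv (A B : {vspace 'rV[L]_2} -> Prop) : Prop :=
  exists g : {'GL_2[L]}, forall Q, B Q <-> exists2 P, A P & Q = GL_act g P.

End FiniteField.

(* Main.v *)
Require Import Defs.
From HB Require Import structures.
From mathcomp Require Import all_boot all_order all_algebra all_fingroup.
From mathcomp Require Import cyclic finfield.
From mathcomp Require Import ring zify.

Set Implicit Arguments.
Unset Strict Implicit.

Import Order.TTheory GRing.Theory Num.Theory.
Local Open Scope ring_scope.

(** Write S for the q^s-Frobenius map, K for the subfield of order q^t, and let
    w span E over K, so that L = K + w K.

    A linear set only depends on its underlying F_q-subspace, hence it is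
    enough to find an invertible matrix that carries T^2 onto the graph of f.
    The vectors of T^2 are the pairs (a, b) with a = x + w S(x) and
    b = y + w S(y), where x and y run over K. For lam in K outside F_q, the
    coordinate
      z = b - lam a = (y - lam x) + w (S(y) - lam S(x))
    determines x and y: its two K-components u and v satisfy
    v - S(u) = (S(lam) - lam) S(x). It therefore takes every value of L once,
    and in the coordinates (z, a) the subspace T^2 is the graph of a
    q-polynomial g with
      g(z) = (S^-1(v) - u) / (lam - S^-1(lam)) + w (v - S(u)) / (S(lam) - lam).
    The components u and v are the polynomials (z + z^(q^t)) / 2 and
    (z - z^(q^t)) / (2 w) in z, so g only involves the exponents q^j with j one
    of 0, t, s, t + s, t - s and 2t - s modulo 2t.

    It remains to relate lam and mu. As mu has norm 1, Hilbert's Theorem 90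
    for the generator S of Gal(K / F_q) gives mu = rho / S(rho)
    ([hilbert90]), and mu != 1 says that rho is outside F_q. With
    lam = S(rho), the polynomial of the theorem takes the value
    al * a + be * z at z, for a nonzero constant al and some constant be
    ([T_poly_T]); that is, f is al * g plus a multiple of X, and the map
    (a, b) |-> (z, al * a + be * z) is in GL_2(L).

    When t is even, mu = -1 has norm 1, the two terms in X^(q^t) vanish, and f
    is 4 w times the shorter polynomial with m = w^-(q^r + 1), r = t - s mod
    2t. Since r is odd, (q^r + 1) / (q + 1) is an odd integer n, so
    m = e^(q + 1) with e = w^-n, and e is in E because n is odd. *)

(** * Powers in a finite field *)

(** The multiplicative group is cyclic, of order d n: its elements of order
    dividing n are the d-th powers. *)
Lemma finField_root_of_unity_power (L : finFieldType) (d n : nat) (x : L) :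
  #|L|.-1 = (d * n)%N -> x ^+ n = 1 -> exists y, x = y ^+ d.
Proof.
set N := #|L|.-1 => dnE xn1.
have SN : N.+1 = #|L| by rewrite /N prednK //; apply: ltnW; exact: finNzRing_gt1.
have N_gt0 : (0 < N)%N by rewrite -ltnS SN; exact: finNzRing_gt1.
have n_gt0 : (0 < n)%N by move: N_gt0; rewrite dnE muln_gt0 => /andP[].
have unity (z : L) : z != 0 -> z ^+ N = 1.
  by move=> z0; apply: (mulfI z0); rewrite -exprS mulr1 SN expf_card.
have /hasP[g _ gP] : has N.-primitive_root (enum (predC1 (0 : L))).
  apply: has_prim_root => //; last 2 first.
  - exact: enum_uniq.
  - by rewrite -cardE cardC1.
  by apply/allP => z; rewrite mem_enum => z0; apply/unity_rootP/unity.
have x0 : x != 0.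
  by apply: contra_eq_neq xn1 => ->; rewrite expr0n gtn_eqF // eq_sym oner_neq0.
have [k xE] := prim_rootP gP (unity x x0).
have : (d * n %| k * n)%N by rewrite -dnE (prim_order_dvd gP) exprM -xE xn1.
rewrite dvdn_pmul2r // => /dvdnP[c kE].
by exists (g ^+ c); rewrite xE kE exprM.
Qed.

(** * Linear sets and matrices *)

Section GLEquivalence.

Variable L : finFieldType.

Lemma GL_equiv_mulmx (U V : {set 'rV[L]_2}) (M : 'M[L]_2) :
  M \in unitmx -> V = [set v *m M | v in U] ->
  GL_equiv (linear_set U) (linear_set V).
Proof.
move=> Mu VE; pose g : {'GL_2[L]} := FinRing.Unit Mu.
have actE v : GL_act g <[v]>%VS = <[v *m M]>%VS.
  by rewrite /GL_act limg_line lfunE.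
have M0 v : v *m M = 0 -> v = 0.
  by move=> vM; rewrite -[v](mulmxK Mu) vM mul0mx.
exists g => Q; split=> [[_ [/[!VE]/imsetP[v vU ->] v0 ->]]|[_ [v [vU v0 ->]] ->]].
  exists <[v]>%VS; last by rewrite actE.
  by exists v; split=> //; apply: contraNneq v0 => ->; rewrite mul0mx.
exists (v *m M); split; last exact: actE.
  by rewrite VE; apply/imsetP; exists v.
by apply: contraNneq v0 => /M0 ->.
Qed.

Definition mx22 (a b c d : L) : 'M[L]_2 :=
  \matrix_(i, j) if i == 0 then (if j == 0 then a else b)
                 else (if j == 0 then c else d).

Lemma mul_vec2_mx22 (x y a b c d : L) :
  vec2 x y *m mx22 a b c d = vec2 (x * a + y * c) (x * b + y * d).
Proof.
by apply/rowP=> j; rewrite !mxE big_ord_recl big_ord1 !mxE /=; case: ifP.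
Qed.

Lemma mx22_unit (a b c d : L) : a * d - b * c != 0 -> mx22 a b c d \in unitmx.
Proof.
move=> D0; suff -> : mx22 a b c d \in unitmx = (a * d - b * c != 0) by [].
rewrite unitmxE unitfE (expand_det_row _ 0) big_ord_recl big_ord1 /cofactor.
by rewrite !det_mx11 !mxE /= expr0 expr1 mul1r mulN1r mulrN.
Qed.

(** The matrix is that of (a, b) |-> (b - lam a, al a + be (b - lam a)), of
    determinant - al. *)
Lemma GL_equiv_graph (A : {set L}) (f : {poly L}) (lam al be : L) :
    al != 0 ->
    (forall z, exists a b, [/\ a \in A, b \in A & z = b - lam * a]) ->
    (forall a b, a \in A -> b \in A ->
       f.[b - lam * a] = al * a + be * (b - lam * a)) ->
  GL_equiv (linear_set (square A)) (linear_set (graph f)).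
Proof.
move=> al0 Asurj fE.
apply: (@GL_equiv_mulmx _ _ (mx22 (- lam) (al - be * lam) 1 be)).
  by apply: mx22_unit; rewrite (_ : _ - _ = - al) ?oppr_eq0 //; ring.
have gE a b : a \in A -> b \in A ->
    vec2 a b *m mx22 (- lam) (al - be * lam) 1 be
      = vec2 (b - lam * a) f.[b - lam * a].
  by move=> aA bA; rewrite mul_vec2_mx22 fE //; congr vec2; ring.
apply/setP=> v; apply/imsetP/imsetP=> [[z _ ->]|[_ /imset2P[a b aA bA ->] ->]].
  have [a [b [aA bA ->]]] := Asurj z.
  by exists (vec2 a b); rewrite ?gE //; apply/imset2P; exists a b.
by rewrite gE //; exists (b - lam * a).
Qed.

End GLEquivalence.

(** * Frobenius powers *)

Section Frobenius.

Variables (q t : nat) (L : finFieldType).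
Hypotheses (q_pp : prime_power q) (t_gt0 : (0 < t)%N).
Hypothesis cardL : #|L| = (q ^ (2 * t))%N.

Lemma q_gt1 : (1 < q)%N.
Proof.
have [p [e [p_pr e0 ->]]] := q_pp.
by rewrite -(exp1n e) ltn_exp2r // prime_gt1.
Qed.

Lemma pchar_base : exists p e, [/\ p \in [pchar L], (0 < e)%N & q = (p ^ e)%N].
Proof.
have [p [e [p_pr e0 qE]]] := q_pp; exists p, e; split=> //.
by rewrite (@card_finPcharP _ _ (e * (2 * t))%N) // cardL qE -expnM.
Qed.

Lemma pnat_frob n : ([pchar L]).-nat (q ^ n)%N.
Proof.
have [p [e [pP _ ->]]] := pchar_base.
by rewrite !pnatX pnatE ?pP // (pcharf_prime pP).
Qed.

Lemma frobD n (x y : L) : (x + y) ^+ (q ^ n) = x ^+ (q ^ n) + y ^+ (q ^ n).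
Proof. by rewrite exprDn_pchar ?pnat_frob. Qed.

Lemma frob_comp m n (x : L) : (x ^+ (q ^ m)) ^+ (q ^ n) = x ^+ (q ^ (m + n)).
Proof. by rewrite -exprM expnD. Qed.

Lemma frob_fixed_mul m k (x : L) : x ^+ (q ^ m) = x -> x ^+ (q ^ (k * m)) = x.
Proof.
by move=> xm; elim: k => // k IHk; rewrite mulSn -frob_comp xm IHk.
Qed.

Lemma frob_qpow (j : int) (n : nat) (x : L) :
  (j = n%:Z %[mod (2 * t)%:Z])%Z -> x ^+ qpow q t j = x ^+ (q ^ n).
Proof.
move=> jE; rewrite /qpow jE modz_nat absz_nat {2}(divn_eq n (2 * t)).
rewrite -frob_comp (@frob_fixed_mul (2 * t)) //.
by rewrite -cardL expf_card.
Qed.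

Local Notation K := (subfield_qt L q t).

Lemma subfieldE x : (x \in K) = (x ^+ (q ^ t) == x).
Proof. by rewrite inE. Qed.

(** First mu = y^(q - 1) with y in K, because mu is a root of unity of order
    dividing (q^t - 1) / (q - 1) in a cyclic group of order q^(2t) - 1. As s is
    invertible modulo t, some power a of the q^s-Frobenius map is the
    q-Frobenius map on K, and then the product of y^(q^(s i)) for i < a is the
    inverse of rho by telescoping. *)
Lemma hilbert90 s (mu : L) :
    (0 < s)%N -> gcdn s t = 1%N -> norm_qt q t mu = 1 ->
  exists rho, [/\ rho \in K, rho != 0 & rho = mu * rho ^+ (q ^ s)].
Proof.
move=> s_gt0 st1 muN.
have q1 := q_gt1.
pose M := ((q ^ t - 1) %/ (q - 1))%N.
have M_gt0 : (0 < M)%N.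
  by rewrite divn_gt0 ?subn_gt0 // leq_sub2r // -[leqLHS]expn1 leq_exp2l.
have mu0 : mu != 0.
  apply: contra_eq_neq muN => ->.
  by rewrite /norm_qt -/M expr0n gtn_eqF // eq_sym oner_neq0.
have ME : (M * (q - 1) = q ^ t - 1)%N.
  by rewrite divnK // !subn1 dvdn_pred_predX.
have cE : #|L|.-1 = ((q ^ t + 1) * (q - 1) * M)%N.
  rewrite -mulnA [(_ * M)%N]mulnC ME cardL mul2n -addnn expnD.
  by have := expn_gt0 q t; rewrite (ltnW q1); nia.
have [y0 muE] := finField_root_of_unity_power cE muN.
have y00 : y0 != 0.
  apply: contra_neq mu0 => y0E.
  by rewrite muE y0E expr0n muln_eq0 addn1 subn_eq0 leqNgt q1.
pose y := y0 ^+ (q ^ t + 1).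
have yK : y ^+ (q ^ t) = y.
  rewrite /y -exprM mulnDl -expnD addnn -mul2n mul1n exprD -cardL expf_card.
  by rewrite -exprS -addn1.
have y_neq0 : y != 0 by rewrite expf_neq0.
have muy : mu * y = y ^+ q.
  by rewrite muE exprM -/y -exprSr subn1 prednK // ltnW.
have [[a b] /= abE] : exists u : nat * nat, (u.1 * s - u.2 * t = 1)%N.
  by apply/coprimeP; rewrite ?/coprime ?st1.
(* y ^+ S is the telescoping product *)
pose S := (\sum_(i < a) (q ^ s) ^ i)%N.
pose r := y ^+ S.
have r0 : r != 0 by rewrite expf_neq0.
have rE : mu * r = r ^+ (q ^ s).
  apply: (mulIf y_neq0); rewrite mulrAC muy.
  rewrite /r -exprM -exprD -exprSr.
  have aS : ((q ^ s) ^ a = (q ^ s - 1) * S + 1)%N.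
    by rewrite subn1 -predn_exp addn1 prednK // !expn_gt0 (ltnW q1).
  have -> : (S * q ^ s).+1 = (q ^ (a * s) + S)%N.
    rewrite mulnC [(a * s)%N]mulnC expnM aS.
    by have := expn_gt0 q s; rewrite (ltnW q1); nia.
  have -> : (a * s = b * t + 1)%N by lia.
  by rewrite !exprD -frob_comp (frob_fixed_mul _ yK) expn1.
exists r^-1; split; rewrite ?invr_eq0 //.
  by rewrite subfieldE exprVn /r exprAC yK.
by rewrite exprVn -rE invfM mulrA divff // mul1r.
Qed.

Variable s : nat.
Hypothesis s_gt0 : (0 < s)%N.

(** N = - s modulo 2t, so that x |-> x^(q^N) inverts x |-> x^(q^s) on L. *)
Let N := (s * (2 * t).-1)%N.

Lemma addsN : (s + N = s * (2 * t))%N.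
Proof. by rewrite /N; nia. Qed.

Lemma frob_s (x : L) : x ^+ qpow q t s%:Z = x ^+ (q ^ s).
Proof. exact: frob_qpow. Qed.

Lemma frob_t (x : L) : x ^+ qpow q t t%:Z = x ^+ (q ^ t).
Proof. exact: frob_qpow. Qed.

Lemma frob_tDs (x : L) : x ^+ qpow q t (t%:Z + s%:Z) = x ^+ (q ^ (t + s)).
Proof. exact: frob_qpow. Qed.

Lemma frob_2tBs (x : L) : x ^+ qpow q t ((2 * t)%:Z - s%:Z) = x ^+ (q ^ N).
Proof.
apply: frob_qpow; have -> : N%:Z = (s.-1%:Z * (2 * t)%:Z + ((2 * t)%:Z - s%:Z)).
  by have := addsN; nia.
by rewrite modzMDl.
Qed.

Lemma frob_tBs (x : L) : x ^+ qpow q t (t%:Z - s%:Z) = x ^+ (q ^ (t + N)).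
Proof.
apply: frob_qpow.
have -> : (t + N)%N%:Z = (s%:Z * (2 * t)%:Z + (t%:Z - s%:Z)).
  by have := addsN; nia.
by rewrite modzMDl.
Qed.

Lemma frob_sK (x : L) : (x ^+ (q ^ s)) ^+ (q ^ N) = x.
Proof. by rewrite frob_comp addsN frob_fixed_mul // -cardL expf_card. Qed.

Hypothesis q_odd : odd q.

Lemma two_neq0 : 2 != 0 :> L.
Proof.
have [p [e [pP e0 qE]]] := pchar_base.
apply/eqP=> two0; have : q%:R == 0 :> L.
  by rewrite qE natrX (pcharf0 pP) expr0n gtn_eqF.
by rewrite -(odd_double_half q) q_odd -muln2 natrD natrM two0 mulr0 addr0 oner_eq0.
Qed.

Lemma frobN n (x : L) : (- x) ^+ (q ^ n) = - x ^+ (q ^ n).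
Proof. by rewrite exprNn -signr_odd oddX q_odd orbT expr1 mulN1r. Qed.

Lemma frobB n (x y : L) : (x - y) ^+ (q ^ n) = x ^+ (q ^ n) - y ^+ (q ^ n).
Proof. by rewrite frobD frobN. Qed.

(** * The subspace T^2 as a graph *)

Variable w : L.
Hypotheses (wE : w ^+ (q ^ t) = - w) (w_neq0 : w != 0).

Definition T_poly (mu : L) : {poly L} :=
  (mu ^+ qpow q t s%:Z - 1) *:
    ((mu + 1) *: 'X^(qpow q t t%:Z)
     - (2 * (w ^+ qpow q t (t%:Z - s%:Z))^-1) *:
         ('X^(qpow q t (t%:Z - s%:Z))
          - 'X^(qpow q t ((2 * t)%:Z - s%:Z))))
  + (mu - 1) *:
    ((mu ^+ qpow q t s%:Z + 1) *: 'X^(qpow q t t%:Z)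
     + (2 * w * mu ^+ qpow q t s%:Z) *:
         ('X^(qpow q t s%:Z) + 'X^(qpow q t (t%:Z + s%:Z)))).

(** The two binomials are Frobenius powers of z + z^(q^t) and z^(q^t) - z,
    which are the components of z up to factors in 2 and w; the sign changes
    because w^(q^(t - s)) is - w^(q^N). *)
Lemma T_poly_horner (mu z : L) :
  (T_poly mu).[z] =
    (mu ^+ (q ^ s) - 1) *
      ((mu + 1) * z ^+ (q ^ t)
       + 2 * (w ^+ (q ^ N))^-1 * (z ^+ (q ^ t) - z) ^+ (q ^ N))
    + (mu - 1) *
      ((mu ^+ (q ^ s) + 1) * z ^+ (q ^ t)
       + 2 * w * mu ^+ (q ^ s) * (z + z ^+ (q ^ t)) ^+ (q ^ s)).
Proof.
rewrite /T_poly !(hornerE, hornerXn) !frob_s !frob_t !frob_tDs !frob_tBs !frob_2tBs.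
by rewrite frobB frobD !frob_comp -[w ^+ (q ^ (t + N))]frob_comp wE frobN invrN; ring.
Qed.

Section Witness.

Variables (rho mu : L).
Hypotheses (rhoK : rho \in K) (rho_neq0 : rho != 0) (mu_neq1 : mu != 1).
Hypothesis rhoE : rho = mu * rho ^+ (q ^ s).

(** In f(z) = al * a + be * z, written for z = u + w v, al is read off the
    coefficient of the Frobenius inverse of v, and be is the multiple of X that
    gives u and v the same coefficients on both sides. *)
Let al : L := - 4 * (rho ^+ (q ^ s) - rho ^+ (q ^ s) ^+ (q ^ s))
               * (rho ^+ (q ^ s) - rho) / rho ^+ (q ^ s) ^+ (q ^ s).
Let be : L := 2 * mu * mu ^+ (q ^ s) + 2 - 4 * mu ^+ (q ^ s).

Lemma rho_s_neq : rho ^+ (q ^ s) != rho.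
Proof.
apply: contra_neq mu_neq1 => rhos.
by apply: (mulIf rho_neq0); rewrite mul1r -{1}rhos -rhoE.
Qed.

Lemma four_neq0 : 4 != 0 :> L.
Proof. by rewrite (natrM _ 2 2) mulf_neq0 ?two_neq0. Qed.

Lemma al_neq0 : al != 0.
Proof.
rewrite /al !mulf_neq0 ?invr_eq0 ?expf_neq0 ?oppr_eq0 ?four_neq0 ?subr_eq0 ?rho_s_neq //.
rewrite -subr_eq0 -frobB expf_neq0 // subr_eq0 eq_sym; exact: rho_s_neq.
Qed.

(** The K-components of z = b - rho^(q^s) a are u = y - rho^(q^s) x and
    v0^(q^s) with v0 = y - rho x. The choice lam = rho^(q^s) makes the second
    one a Frobenius power, which undoes the exponent q^(2t - s) of the
    polynomial; the rest is an identity of rational functions. *)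
Lemma T_poly_T (x y : L) (a := x + w * x ^+ (q ^ s)) (b := y + w * y ^+ (q ^ s))
    (z := b - rho ^+ (q ^ s) * a) :
  x \in K -> y \in K -> (T_poly mu).[z] = al * a + be * z.
Proof.
rewrite !subfieldE => /eqP xK /eqP yK.
have := rhoK; rewrite subfieldE => /eqP rK.
pose u := y - rho ^+ (q ^ s) * x; pose v0 := y - rho * x.
have uK : u ^+ (q ^ t) = u by rewrite frobB exprMn exprAC rK xK yK.
have v0K : v0 ^+ (q ^ t) = v0 by rewrite frobB exprMn rK xK yK.
have zE : z = u + w * v0 ^+ (q ^ s).
  by rewrite /z /u /v0 /a /b frobB exprMn; ring.
have zt : z ^+ (q ^ t) = u - w * v0 ^+ (q ^ s).
  by rewrite zE frobD exprMn uK wE exprAC v0K mulNr.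
rewrite T_poly_horner zt.
have -> : u - w * v0 ^+ (q ^ s) - z = - (w * v0 ^+ (q ^ s) + w * v0 ^+ (q ^ s)).
  by rewrite zE; ring.
have -> : z + (u - w * v0 ^+ (q ^ s)) = u + u by rewrite zE; ring.
rewrite frobN [(w * _ + _) ^+ _]frobD [(u + u) ^+ _]frobD [(w * _) ^+ (q ^ N)]exprMn.
rewrite frob_sK {}zE /u /v0 /a !frobB !exprMn.
have muE : mu = rho / rho ^+ (q ^ s).
  by rewrite {1}rhoE mulfK // expf_neq0.
rewrite /al /be muE expr_div_n.
have r1 : rho ^+ (q ^ s) != 0 by rewrite expf_neq0.
have r2 : rho ^+ (q ^ s) ^+ (q ^ s) != 0 by rewrite !expf_neq0.
have w0 : w ^+ (q ^ N) != 0 by rewrite expf_neq0.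
move: (rho ^+ (q ^ s) ^+ (q ^ s)) (rho ^+ (q ^ s)) (w ^+ (q ^ N)) r1 r2 w0.
move: (x ^+ (q ^ s)) (y ^+ (q ^ s)) => X Y R2 R1 W r1 r2 w0.
by field; rewrite ?r1 ?r2 ?w0.
Qed.

(** Solve y - rho^(q^s) x = u and y - rho x = v0, a linear system of
    determinant rho^(q^s) - rho, where z = u + w v0^(q^s). *)
Lemma T_surj (z : L) :
  exists a b, [/\ a \in Tset q t s w, b \in Tset q t s w
                & z = b - rho ^+ (q ^ s) * a].
Proof.
have := rhoK; rewrite subfieldE => /eqP rK.
have zK : z ^+ (q ^ t) ^+ (q ^ t) = z by rewrite frob_comp addnn -mul2n -cardL expf_card.
have two0 := two_neq0.
pose u := (z + z ^+ (q ^ t)) / 2.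
pose v := (z - z ^+ (q ^ t)) / (2 * w).
have twoK : 2 ^+ (q ^ t) = 2 :> L by rewrite (natrD _ 1 1) frobD expr1n.
have uK : u ^+ (q ^ t) = u.
  by rewrite /u exprMn exprVn twoK frobD zK addrC.
have vK : v ^+ (q ^ t) = v.
  by rewrite /v exprMn exprVn exprMn twoK frobB zK wE mulrN invrN mulrN -mulNr opprB.
pose v0 := v ^+ (q ^ N).
have v0s : v0 ^+ (q ^ s) = v by rewrite /v0 exprAC frob_sK.
have v0K : v0 ^+ (q ^ t) = v0 by rewrite /v0 exprAC vK.
pose x := (v0 - u) / (rho ^+ (q ^ s) - rho).
pose y := u + rho ^+ (q ^ s) * x.
have xK : x ^+ (q ^ t) = x.
  by rewrite /x exprMn exprVn !frobB v0K uK rK exprAC rK.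
have yK : y ^+ (q ^ t) = y by rewrite /y frobD uK exprMn xK exprAC rK.
have yx : y - rho * x = v0.
  rewrite /y /x; field; rewrite subr_eq0; exact: rho_s_neq.
exists (x + w * x ^+ (q ^ s)), (y + w * y ^+ (q ^ s)); split.
- by apply/imsetP; exists x; rewrite // subfieldE xK.
- by apply/imsetP; exists y; rewrite // subfieldE yK.
have -> : y + w * y ^+ (q ^ s) - rho ^+ (q ^ s) * (x + w * x ^+ (q ^ s))
    = (y - rho ^+ (q ^ s) * x) + w * (y - rho * x) ^+ (q ^ s).
  by rewrite [(y - _) ^+ _]frobB [(rho * _) ^+ _]exprMn; ring.
rewrite yx v0s /y /v /u; field.
by rewrite two0 w_neq0.
Qed.

(** The factor c accommodates the normalisation of the polynomial for even t. *)
Lemma GL_equiv_T_poly (c : L) (f : {poly L}) :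
  c != 0 -> c *: f = T_poly mu ->
  GL_equiv (linear_set (square (Tset q t s w))) (linear_set (graph f)).
Proof.
move=> c0 cf; apply: (@GL_equiv_graph _ _ _ (rho ^+ (q ^ s)) (al / c) (be / c)).
- by rewrite mulf_neq0 ?invr_eq0 ?al_neq0.
- exact: T_surj.
move=> _ _ /imsetP[x xK ->] /imsetP[y yK ->]; apply: (mulfI c0).
rewrite -hornerZ cf T_poly_T //; field; exact: c0.
Qed.

End Witness.

End Frobenius.

(** * Parity *)

Lemma odd_sum_expn (q t : nat) : odd q -> odd (\sum_(i < t) q ^ i) = odd t.
Proof.
move=> q_odd; elim: t => [|t IHt]; first by rewrite big_ord0.
by rewrite big_ord_recr /= oddD IHt oddX q_odd orbT addbT.
Qed.

(** The cofactor is the alternating sum of the q^i for i < r, which has an odd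
    number of odd terms. *)
Lemma odd_cofactor_expnD1 (q r : nat) : odd q -> odd r ->
  exists2 n, odd n & (q ^ r + 1 = n * (q + 1))%N.
Proof.
move=> q_odd r_odd; rewrite -(odd_double_half r) r_odd add1n.
elim: r./2 => [|k [n n_odd nE]]; first by exists 1%N; rewrite ?expn1 ?mul1n.
(* q^(r + 2) + 1 = q^2 (q^r + 1) - (q^2 - 1) *)
exists (q ^ 2 * n - (q - 1))%N; last first.
  have sqE : ((q - 1) * (q + 1) = q ^ 2 - 1)%N by rewrite -subn_sqr exp1n.
  rewrite mulnBl sqE -mulnA -nE mulnDr muln1 -expnD doubleS add2n.
  have : (0 < q ^ 2)%N by rewrite expn_gt0 odd_gt0.
  by lia.
have q_gt0 := odd_gt0 q_odd; have n_gt0 := odd_gt0 n_odd.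
rewrite oddB; last first.
  by rewrite -mulnn -mulnA (leq_trans (leq_subr 1 q)) // leq_pmulr // muln_gt0 q_gt0.
by rewrite oddM n_odd oddX q_odd oddB // q_odd.
Qed.

Theorem theorem3p5 (q t s : nat) (L : finFieldType) (w : L)
    (q_pp : prime_power q) (q_odd : odd q)
    (t_ge3 : (3 <= t)%N) (s_gt0 : (0 < s)%N) (cop_st : gcdn s t = 1%N)
    (cardL : #|L| = (q ^ (2 * t))%N)
    (wE : w \in Eset L q t) (w_neq0 : w != 0)
    (Nw : norm_qt q t (w ^+ 2) != (-1) ^+ t) :
  (forall mu : L, mu \in subfield_qt L q t -> norm_qt q t mu = 1 -> mu != 1 ->
     GL_equiv (linear_set (square (Tset q t s w)))
       (linear_set (graph
          ((mu ^+ qpow q t s%:Z - 1) *: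
             ((mu + 1) *: 'X^(qpow q t t%:Z)
              - (2 * (w ^+ qpow q t (t%:Z - s%:Z))^-1) *:
                  ('X^(qpow q t (t%:Z - s%:Z))
                   - 'X^(qpow q t ((2 * t)%:Z - s%:Z))))
           + (mu - 1) *:
             ((mu ^+ qpow q t s%:Z + 1) *: 'X^(qpow q t t%:Z)
              + (2 * w * mu ^+ qpow q t s%:Z) *:
                  ('X^(qpow q t s%:Z) + 'X^(qpow q t (t%:Z + s%:Z))))))))
  /\
  (~~ odd t ->
     exists (e m : L), [/\ e \in Eset L q t, e != 0, m = e ^+ (q + 1)
       & GL_equiv (linear_set (square (Tset q t s w)))
           (linear_set (graph
              ('X^(qpow q t s%:Z) + 'X^(qpow q t (t%:Z + s%:Z))
               + m *: ('X^(qpow q t (t%:Z - s%:Z))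
                       - 'X^(qpow q t ((2 * t)%:Z - s%:Z))))))]).
Proof.
have wt : w ^+ (q ^ t) = - w.
  by apply/eqP; rewrite -addr_eq0; move: wE; rewrite inE.
have t_gt0 : (0 < t)%N by lia.
have H (mu c : L) (f : {poly L}) :
    mu \in subfield_qt L q t -> norm_qt q t mu = 1 -> mu != 1 ->
    c != 0 -> c *: f = T_poly q t s w mu ->
    GL_equiv (linear_set (square (Tset q t s w))) (linear_set (graph f)).
  move=> muK muN mu1.
  have [rho [rhoK rho0 rhoE]] := hilbert90 q_pp t_gt0 cardL s_gt0 cop_st muN.
  exact: (GL_equiv_T_poly q_pp t_gt0 cardL s_gt0 q_odd wt w_neq0 rhoK rho0 mu1 rhoE).
split=> [mu muK muN mu1|t_even].
  by apply: (H mu 1); rewrite ?oner_neq0 ?scale1r.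
have two0 : 2 != 0 :> L by exact: (two_neq0 q_pp cardL).
have s_odd : odd s.
  apply: contraT => s_even.
  have : (2 %| gcdn s t)%N by rewrite dvdn_gcd !dvdn2 s_even t_even.
  by rewrite cop_st.
(* r = t - s modulo 2t *)
pose r := (t + s * (2 * t).-1)%N.
have r_odd : odd r.
  by rewrite /r oddD oddM s_odd (negPf t_even) -subn1 oddB ?oddM //; lia.
have [n n_odd nE] := odd_cofactor_expnD1 q_odd r_odd.
exists (w ^+ n)^-1, ((w ^+ n)^-1 ^+ (q + 1)); split=> //.
- by rewrite inE exprVn exprAC wt exprNn -signr_odd n_odd mulN1r invrN addNr.
- by rewrite invr_eq0 expf_neq0.
apply: (H (-1) (4 * w)).
- by rewrite inE frobN ?expr1n.
- have M_def : ((q ^ t - 1) %/ (q - 1) = \sum_(i < t) q ^ i)%N.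
    by rewrite !subn1 predn_exp mulKn // -subn1 subn_gt0 (q_gt1 q_pp).
  by rewrite /norm_qt M_def -signr_odd odd_sum_expn // (negPf t_even).
- by rewrite -subr_eq0 -opprD oppr_eq0.
- by rewrite mulf_neq0 // (natrM _ 2 2) mulf_neq0.
rewrite /T_poly frob_s // frobN // expr1n addNr !scale0r add0r add0r.
rewrite frob_tBs // -/r -exprVn -exprM -nE.
rewrite scalerDr scalerN -scaleNr !scalerA [RHS]addrC.
rewrite exprD expr1 exprVn.
have wr0 : w ^+ (q ^ r) != 0 by rewrite expf_neq0.
congr (_ *: _ + _ *: _); first by ring.
by field; rewrite wr0 w_neq0.
Qed.
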